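(* Let $X$ be a finite well-layered prechart and let $R$ be a bisimulation equivalence on $X$. Then the quotient prechart $X/R$ is well-layered.
   Context: Fix a finite set $A$. A prechart is $(X,\langle o,\partial\rangle)$ with $o\colon X\to 2^A$, $\partial\colon X\to\mathcal P_\omega(X)^A$ ($\mathcal P_\omega$ = finite subsets); $x\Rightarrow a$ means $o(x)(a)=1$, $x\xrightarrow{a}y$ means $y\in\partial(x)(a)$. A bisimulation equivalence on $X$ is an equivalence relation $R$ such that for all $(x,y)\in R$ and $a\in A$: $x\Rightarrow a$ iff $y\Rightarrow a$; if $x\xrightarrow{a}x'$ then $y\xrightarrow{a}y'$ for some $y'$ with $(x',y')\in R$; and symmetrically. $X/R$ is the prechart on equivalence classes with $[x]\Rightarrow a$ iff $x\Rightarrow a$ and $[x]\xrightarrow{a}[y]$ iff $x\xrightarrow{a}y'$ for some $y'\in[y]$. Well-layered: the underlying transition system of a prechart has $x\Rightarrow$ iff $x\Rightarrow a$ for some $a$, and $x\to y$ iff $x\xrightarrow{a}y$ for some $a$. An entry/body labelling assigns to the transitions labels $\mathsf e$, $\mathsf b$ (each transition $x\to y$ gets at least one label, giving $x\to_{\mathsf e}y$ and/or $x\to_{\mathsf b}y$, and only transitions are labelled). Write $x\curvearrowright y$ if there are $n\ge1$, $v_1,\dots,v_n=y$ with $x\to_{\mathsf e}v_1\to_{\mathsf b}\cdots\to_{\mathsf b}v_n$ and $x\notin\{v_1,\dots,v_n\}$; $^+$ denotes transitive closure. A layering witness is an entry/body labelling that is locally finite (finitely many states reachable from each state), flat ($x\to_{\mathsf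 e}y$ implies not $x\to_{\mathsf b}y$), fully specified (never $x\to_{\mathsf b}^+x$; and $x\to_{\mathsf e}y$ with $y\ne x$ implies $y\to^+x$), layered ($(X,\curvearrowright)$ acyclic) and goto-free ($x\curvearrowright y$ implies not $y\Rightarrow$). A prechart is well-layered if its underlying transition system has a layering witness. *)

(* Defs.v *)
From Stdlib Require Import Relations.
From HB Require Import structures.
From mathcomp Require Import all_boot generic_quotient finmap.

Set Implicit Arguments.
Unset Strict Implicit.
Unset Printing Implicit Defensive.

Local Open Scope quotient_scope.
Local Open Scope fset_scope.

Record prechart (A : finType) (X : choiceType) := Prechart {
  output : X -> A -> bool;
  deriv : X -> A -> {fset X}
}.

Definition bisimulation (A : finType) (X : choiceType) (P : prechart A X)
    (R : rel X) : Prop :=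
  forall x y, R x y -> forall a,
    [/\ output P x a <-> output P y a,
        (forall x', x' \in deriv P x a ->
           exists2 y', y' \in deriv P y a & R x' y')
      & (forall y', y' \in deriv P y a ->
           exists2 x', x' \in deriv P x a & R x' y')].

(* The structure of a class is read off its canonical representative; by
   [output_quotient] and [deriv_quotient] below, this does not depend on the
   representative when [R] is a bisimulation. *)
Definition quotient_prechart (A : finType) (X : choiceType) (P : prechart A X)
    (R : equiv_rel X) : prechart A {eq_quot R} :=
  Prechart
    (fun (q : {eq_quot R}) a => output P (repr q) a)
    (fun (q : {eq_quot R}) a =>
       [fset \pi_({eq_quot R}) y | y in deriv P (repr q) a]).

Lemma output_quotient (A : finType) (X : choiceType) (P : prechart A X)
    (R : equiv_rel X) (hR : bisimulation P R) (x : X) (a : A) :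
  output (quotient_prechart P R) (\pi x) a <-> output P x a.
Proof.
have Rx : R (repr (\pi_({eq_quot R}) x)) x by apply/eqmodP; rewrite reprK.
by have [] := hR _ _ Rx a.
Qed.

Lemma deriv_quotient (A : finType) (X : choiceType) (P : prechart A X)
    (R : equiv_rel X) (hR : bisimulation P R) (x y : X) (a : A) :
  \pi y \in deriv (quotient_prechart P R) (\pi x) a <->
  exists2 y', R y' y & y' \in deriv P x a.
Proof.
have Rx : R (repr (\pi_({eq_quot R}) x)) x by apply/eqmodP; rewrite reprK.
have [_ h1 h2] := hR _ _ Rx a; split.
  case/imfsetP=> z /= /h1 [y' y'x Rzy'] /eqmodP Ryz; exists y' => //.
  by rewrite equiv_sym (equiv_trans Ryz).
case=> y' Ry' /h2 [z zx Rzy']; apply/imfsetP; exists z => //=.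
by apply/eqmodP; rewrite equiv_sym (equiv_trans Rzy').
Qed.

Record transition_system (X : choiceType) := TransitionSystem {
  accepts : pred X;
  step : rel X
}.

Definition underlying (A : finType) (X : choiceType) (P : prechart A X) :
    transition_system X :=
  TransitionSystem
    [pred x | [exists a, output P x a]]
    [rel x y | [exists a, y \in deriv P x a]].

Definition entry_body_labelling (X : choiceType) (T : transition_system X)
    (e b : rel X) : Prop :=
  forall x y, step T x y <-> e x y \/ b x y.

Definition loops_to (X : choiceType) (e b : rel X) (x y : X) : Prop :=
  exists (v : X) (s : seq X),
    [/\ e x v, path b v s, last v s = y & x \notin v :: s].

Definition locally_finite (X : choiceType) (T : transition_system X) : Prop :=
  forall x, exists s : seq X,
    forall y, clos_refl_trans X (step T) x y -> y \in s.

Definition flat (X : choiceType) (e b : rel X) : Prop :=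
  forall x y, e x y -> ~ b x y.

Definition fully_specified (X : choiceType) (T : transition_system X)
    (e b : rel X) : Prop :=
  (forall x, ~ clos_trans X b x x) /\
  (forall x y, e x y -> y <> x -> clos_trans X (step T) y x).

Definition layered (X : choiceType) (e b : rel X) : Prop :=
  forall x, ~ clos_trans X (loops_to e b) x x.

Definition goto_free (X : choiceType) (T : transition_system X)
    (e b : rel X) : Prop :=
  forall x y, loops_to e b x y -> ~ accepts T y.

Definition layering_witness (X : choiceType) (T : transition_system X)
    (e b : rel X) : Prop :=
  entry_body_labelling T e b /\
  [/\ locally_finite T, flat e b, fully_specified T e b, layered e b
    & goto_free T e b].

Definition well_layered (A : finType) (X : choiceType) (P : prechart A X) :
    Prop :=
  exists e b : rel X, layering_witness (underlying P) e b.

(* Main.v *)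
Require Import Defs.
From Stdlib Require Import Relations.
From HB Require Import structures.
From mathcomp Require Import all_boot generic_quotient finmap.

Set Implicit Arguments.
Unset Strict Implicit.
Unset Printing Implicit Defensive.

Local Open Scope quotient_scope.

(** Call an edge [x -> y] of a relation [B] a loop edge when [y] reaches [x] in
    [B] and every [B]-path from [y] that avoids [x] is finite and meets no
    accepting state.  Well-layeredness of a finite system is equivalent to:
    every subrelation of the transition relation with a cycle has a loop edge.

    - From a witness: take a header of an entry edge lying on a [B]-cycle that
      is innermost for the loop relation.
    - To a witness: repeatedly delete loop edges, which become the entry edges.
      The loop relation is acyclic as long as no edge is ever deleted at a state
      that lies in the body of a previously deleted loop with another header,
      and [conflict_free_loop_edge] shows that such a choice always exists.

    This criterion passes to quotients: a cyclic subrelation of the quotient has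
    a cyclic preimage, and a loop edge of the preimage projects to a loop edge
    because paths lift along the bisimulation. *)

(** * Paths and cycles in relations on a finite type *)

Section RelationsOnFiniteTypes.
Variable T : finType.
Implicit Types (r : rel T) (x y z h : T).

Definition avoid r x : rel T := fun u v => [&& r u v, u != x & v != x].

Definition on_cycle r z := [exists z', r z z' && connect r z' z].

Lemma on_cycleP r z :
  reflect (exists2 z', r z z' & connect r z' z) (on_cycle r z).
Proof. by apply: (iffP existsP) => [[u /andP[]]|[u ? ?]]; exists u => //; apply/andP. Qed.

Lemma connect_subrel r1 r2 : subrel r1 r2 -> subrel (connect r1) (connect r2).
Proof. by move=> sub; apply: connect_sub => x y /sub/connect1. Qed.

Lemma on_cycle_subrel r1 r2 z : subrel r1 r2 -> on_cycle r1 z -> on_cycle r2 z.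
Proof.
move=> sub /on_cycleP[u zu uz]; apply/on_cycleP.
by exists u; [apply: sub | apply: connect_subrel uz].
Qed.

Lemma avoid_subrel r1 r2 x :
  subrel r1 r2 -> subrel (avoid r1 x) (avoid r2 x).
Proof. by move=> sub u v /and3P[/sub uv ux vx]; apply/and3P. Qed.

Lemma sub_avoid r x : subrel (avoid r x) r.
Proof. by move=> u v /and3P[]. Qed.

Lemma connect_closed r (S : {pred T}) y z :
  (forall u v, u \in S -> r u v -> v \in S) -> connect r y z ->
  y \in S -> z \in S.
Proof.
move=> cl /connectP[p]; elim: p y => [|w p IH] y /=; first by move=> _ ->.
by case/andP=> yw pw lp yS; apply: (IH w) => //; apply: cl yw.
Qed.

Lemma path_avoid r h y p : path r y p -> h \notin y :: p -> path (avoid r h) y p.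
Proof.
elim: p y => [|w p IH] y //= /andP[yw pw].
rewrite !inE !negb_or => /and3P[hy hw hp].
rewrite /avoid yw eq_sym hy eq_sym hw /=; apply: IH => //.
by rewrite inE negb_or hw.
Qed.

(** On a duplicate-free path the endpoint [x] comes after [h], so the segment up to [h] avoids
    [x]. *)
Lemma connect_via r y x h : h != x -> connect r y x ->
  connect (avoid r h) y x \/ connect (avoid r x) y h /\ connect r h x.
Proof.
move=> hx /connectP[p0 pth0 lst0].
have : exists p, [/\ path r y p, uniq (y :: p) & x = last y p].
  by case/shortenP: pth0 lst0 => p pth un _ ->; exists p.
case=> p [pth un lst].
have [hp|hp] := boolP (h \in y :: p); last first.
  by left; apply/connectP; exists p => //; apply: path_avoid.
right; case/splitPl: hp pth un lst => p1 p2 lst1.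
rewrite cat_path last_cat lst1 => /andP[pth1 pth2] un lst2.
split; last by apply/connectP; exists p2.
apply/connectP; exists p1 => //; apply: path_avoid => //.
apply/negP => xp1.
have xp2 : x \in p2.
  by have := mem_last h p2; rewrite -lst2 inE eq_sym (negbTE hx).
move: un; rewrite -cat_cons cat_uniq => /and3P[_ /hasPn/(_ _ xp2)/negP un _].
exact: un.
Qed.

(* A point of [C] with the fewest descendants is a descendant of any point of
   [C] that it reaches. *)
Lemma exists_on_cycle r (C : {pred T}) g0 : g0 \in C ->
  (forall g, g \in C -> exists g1 g', [/\ r g g1, connect r g1 g' & g' \in C]) ->
  exists2 g, g \in C & on_cycle r g.
Proof.
move=> Cg0 next.
case: (arg_minnP (fun g => #|[pred x | connect r g x]|) Cg0) => g Cg gmin.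
have [g1 [g' [rg1 rg' Cg']]] := next g Cg.
exists g => //; apply/on_cycleP; exists g1 => //; apply: (connect_trans rg').
have sub : [pred x | connect r g' x] \subset [pred x | connect r g x].
  apply/subsetP => u; rewrite !inE => g'u.
  exact: connect_trans (connect1 rg1) (connect_trans rg' g'u).
have := subset_leqif_card sub; case=> le eq.
have : #|[pred x | connect r g' x]| == #|[pred x | connect r g x]|.
  by rewrite eqn_leq le gmin.
by rewrite eq => /subsetP/(_ g); rewrite !inE connect0; apply.
Qed.

(** By acyclicity a chain of ancestors has no repetition, so its length is at most [#|T|]; [n] below
    counts the room left. *)
Lemma acyclic_ind (L : T -> T -> Prop) (Q : T -> Prop) :
  (forall x, ~ clos_trans T L x x) ->
  (forall x, (forall y, clos_trans T L x y -> Q y) -> Q x) -> forall x, Q x.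
Proof.
move=> acy ind x.
suff H n (s : seq T) y : uniq s -> size s + n = #|T| ->
    (forall a, a \in s -> clos_trans T L a y) -> Q y.
  exact: (H #|T| [::]).
elim: n s y => [|n IH] s y us ss sy.
  have ys : y \notin s by apply/negP => /sy/acy.
  have uys : uniq (y :: s) by rewrite /= ys.
  by have := max_card (mem (y :: s)); rewrite (card_uniqP uys) /= -ss addn0 ltnn.
apply: ind => z yz; apply: (IH (y :: s)).
- by rewrite /= us andbT; apply/negP => /sy/acy.
- by rewrite /= -ss addnS addSn.
move=> a; rewrite inE => /predU1P[-> //|/sy ay]; exact: t_trans yz.
Qed.

End RelationsOnFiniteTypes.

(** * Loop edges and the elimination criterion *)

Section LoopElimination.
Variables (T : finType) (acc : pred T).
Implicit Types (B : rel T) (x y z h : T).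

(** Since [connect] is reflexive, [z = x] occurs for a self-loop [y = x]; the guard [z != x]
    discards it. *)
Definition eliminable B x y :=
  [forall z, connect (avoid B x) y z ==> (z != x) ==>
     ~~ acc z && ~~ on_cycle (avoid B x) z].

Lemma eliminableP B x y :
  reflect (forall z, connect (avoid B x) y z -> z != x ->
             ~~ acc z /\ ~~ on_cycle (avoid B x) z)
          (eliminable B x y).
Proof.
apply: (iffP forallP) => H z; first by move=> yz zx; have := H z; rewrite yz zx => /andP.
by apply/implyP => yz; apply/implyP => zx; apply/andP; apply: H.
Qed.

Definition loop_edge B x y := [&& B x y, connect B y x & eliminable B x y].

Definition loop_eliminating (step : rel T) : Prop :=
  forall B, subrel B step -> (exists z, on_cycle B z) ->
  exists x y, loop_edge B x y.

End LoopElimination.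

(** * Transfer of the criterion along a map that lifts edges *)

Section Image.
Variables (T T' : finType) (f : T -> T').

(** The back condition of a functional bisimulation. *)
Definition lifts (r : rel T) (r' : rel T') : Prop :=
  forall g h', r' (f g) h' -> exists2 g', r g g' & f g' = h'.

Lemma connect_lift r r' y z :
  lifts r r' -> connect r' (f y) z -> exists2 g, connect r y g & f g = z.
Proof.
move=> lft /connectP[p]; elim: p y => [|w p IH] y /=.
  by move=> _ ->; exists y; rewrite ?connect0.
case/andP=> /lft[g yg <-] pth lst; have [g' gg' <-] := IH g pth lst.
by exists g' => //; apply: connect_trans (connect1 yg) gg'.
Qed.

(** Lifting the cycle again and again leads from one point of the fibre over [f y] to another;
    finiteness makes this recur. *)
Lemma on_cycle_lift r r' y :
  lifts r r' -> on_cycle r' (f y) -> exists2 g, connect r y g & on_cycle r g.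
Proof.
move=> lft cyc.
have [||g /andP[yg _] gcyc] :=
  @exists_on_cycle _ r [pred g | connect r y g & f g == f y] y.
- by rewrite inE connect0 eqxx.
- move=> g; rewrite inE => /andP[yg /eqP fg].
  move: cyc; rewrite -fg => /on_cycleP[z' /lft[g1 gg1 <-] /(connect_lift lft)[g' g1g' fg']].
  exists g1, g'; split=> //; rewrite inE fg' fg eqxx andbT.
  exact: connect_trans yg (connect_trans (connect1 gg1) g1g').
by exists g.
Qed.

Lemma loop_eliminating_image (acc : pred T) (acc' : pred T')
    (step : rel T) (step' : rel T') :
  (forall z, exists y, f y = z) -> lifts step step' ->
  (forall g, acc' (f g) -> acc g) ->
  loop_eliminating acc step -> loop_eliminating acc' step'.
Proof.
move=> surj lft accf elim B' sub' [z cyc].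
pose B : rel T := fun u v => step u v && B' (f u) (f v).
have lftB : lifts B B'.
  move=> g h' gh'; have [g' gg' fg'] := lft _ _ (sub' _ _ gh').
  by exists g' => //; rewrite /B gg' fg'.
have [y fy] := surj z; move: cyc; rewrite -fy => /(on_cycle_lift lftB)[g _ gcyc].
have [||x [w]] := elim B; [by move=> u v /andP[] | by exists g |].
case/and3P=> xw wx /eliminableP el; exists (f x), (f w); apply/and3P; split.
- by case/andP: xw.
- case/connectP: wx => p; elim: p w {xw el} => [|v p IH] w /=.
    by move=> _ ->; rewrite connect0.
  case/andP=> /andP[_ wv] pth lst.
  exact: connect_trans (connect1 wv) (IH _ pth lst).
(* A lifted edge avoids [x] because its image avoids [f x]. *)
have lfta : lifts (avoid B x) (avoid B' (f x)).
  move=> u h' /and3P[/lftB[g' ug' <-] ux g'x]; exists g' => //.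
  by apply/and3P; split=> //; [move: ux | move: g'x]; apply: contra_neq => ->.
apply/eliminableP => _ /(connect_lift lfta)[u wu <-] fux.
have ux : u != x by apply: contra_neq fux => ->.
split; first by apply: contra (accf u) _; case: (el u).
apply/negP => /(on_cycle_lift lfta)[v uv vcyc].
have vx : v != x by case/on_cycleP: vcyc => ? /and3P[].
by have [|_ /negP] := el v _ vx; first exact: connect_trans uv.
Qed.

End Image.

(** * From a layering witness to loop edges *)

Section FromWitness.
Variables (T : finType) (S : transition_system T) (e b : rel T).
Hypothesis wit : layering_witness S e b.

Local Notation body := (clos_trans T (loops_to e b)).

(** An entry step opens a nested loop, which the transitive closure absorbs. A body step extends the
    last loop of the chain or returns to its header, which, not being [x], is already in the
    body. *)
Lemma body_step x u v : body x u -> step S u v -> v != x -> body x v.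
Proof.
have [lab _] := wit; move=> xu /lab uv vx.
have [->//|vu] := eqVneq v u.
case: uv => uv.
  apply: t_trans xu _; apply: t_step; exists v, [::].
  by split=> //; rewrite inE eq_sym.
have ext w : loops_to e b w u -> v != w -> loops_to e b w v.
  case=> w0 [s [ew0 pth lst nin]] vw; exists w0, (rcons s v); split=> //.
  - by rewrite rcons_path pth lst.
  - by rewrite last_rcons.
  by rewrite -rcons_cons mem_rcons inE negb_or eq_sym vw.
have {}xu := clos_trans_tn1 _ _ _ _ xu.
elim: xu ext {uv vu} => [{}u xu|w {}u wu xw _] ext.
  by apply: t_step; apply: ext.
have {}xw := clos_tn1_trans _ _ _ _ xw.
by have [->//|vw] := eqVneq v w; apply: t_trans xw _; apply: t_step; apply: ext.
Qed.

(** Body transitions alone are acyclic, so some edge of the cycle is an entry. *)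
Lemma entry_on_cycle (B : rel T) z : subrel B (step S) -> on_cycle B z ->
  exists x y, [/\ connect B z x, B x y, e x y & connect B y x].
Proof.
have [lab [_ _ [bacyc _] _ _]] := wit; move=> sub /on_cycleP[w zw wz].
case/sub/lab: (zw) => [ezw|bzw]; first by exists z, w; rewrite connect0.
have wb p u : path B u p -> last u p = z -> connect B z u ->
    (exists x y, [/\ connect B z x, B x y, e x y & connect B y x]) \/
    clos_refl_trans T b u z.
  elim: p u => [|v p IH] u /=; first by move=> _ -> _; right; apply: rt_refl.
  case/andP=> uv pth lst zu.
  case/sub/lab: (uv) => [euv|buv].
    left; exists u, v; split=> //; apply: connect_trans zu.
    by apply/connectP; exists p.
  have [?|vz] := IH v pth lst (connect_trans zu (connect1 uv)); first by left.
  by right; apply: rt_trans vz; apply: rt_step.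
have [p pth lst] := connectP wz.
case: (wb p w pth (esym lst) (connect1 zw)) => // bwz.
by case: (bacyc w); apply: clos_rt_t bwz _; apply: t_step.
Qed.

Lemma witness_loop_eliminating : loop_eliminating (accepts S) (step S).
Proof.
have [lab [_ _ _ lay gf]] := wit; move=> B sub [z /(entry_on_cycle sub)].
case=> x0 [y0 [_ xy0 exy0 yx0]].
suff H x : (exists y, [/\ B x y, e x y & connect B y x]) ->
    exists x y, loop_edge (accepts S) B x y by apply: (H x0); exists y0.
move: x; apply: (acyclic_ind lay) => x IH [y [xy exy yx]].
have bodyx u : connect (avoid B x) y u -> u != x -> body x u.
  case/connectP=> p; elim/last_ind: p u => [|p v IHp] u /=.
    move=> _ -> yneq; apply: t_step; exists y, [::].
    by split=> //; rewrite inE eq_sym.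
  rewrite rcons_path last_rcons => /andP[pth /and3P[lv lx vx]] -> _.
  by apply: (body_step (IHp _ pth erefl lx)) => //; apply: sub.
(* A cycle through such a [u] has an entry edge at some [v] in the body of [x], to which the
   induction applies. *)
have [/existsP[u /andP[yu cyc]]|/existsPn acyc] :=
  boolP [exists u, connect (avoid B x) y u && on_cycle (avoid B x) u]; last first.
  exists x, y; apply/and3P; split=> //; apply/eliminableP => u yu ux.
  split; last by have := acyc u; rewrite yu.
  have [w wu] : exists w, loops_to e b w u.
    by case: (clos_trans_tn1 _ _ _ _ (bodyx u yu ux)) => [v|w v]; [exists x | exists w].
  exact/negP/(gf _ _ wu).
have [|v [w [uv vw evw wv]]] := @entry_on_cycle (avoid B x) u _ cyc.
  by move=> ? ? /sub_avoid/sub.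
apply: (IH v); last first.
  by exists w; split=> //; [exact: sub_avoid vw | exact: connect_subrel (@sub_avoid _ _ _) _ _ wv].
by apply: bodyx; [exact: connect_trans uv | case/and3P: vw].
Qed.

End FromWitness.

(** * From loop edges to a layering witness *)

Section ToWitness.
Variables (T : finType) (S : transition_system T).
Implicit Types (B : rel T) (c d : T * {set T}) (hist : seq (T * {set T})).

(** A pair [c] records the header and the body of an eliminated loop; this invariant survives
    further deletions. *)
Definition trapped B c : Prop :=
  (forall u v, u \in c.2 -> avoid B c.1 u v -> v \in c.2) /\
  (forall u, u \in c.2 ->
     [/\ u != c.1, ~~ accepts S u & ~~ on_cycle (avoid B c.1) u]).

Lemma trapped_subrel B B' c : subrel B' B -> trapped B c -> trapped B' c.
Proof.
move=> sub [cl nc]; have suba := @avoid_subrel _ _ _ c.1 sub.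
split=> [u v uc /suba|u /nc[]]; first exact: cl.
by move=> ux au cyc; split=> //; apply: contra cyc; apply: on_cycle_subrel.
Qed.

(* The loop at [x] can only return to [x] through [h].  Hence a path leaving [h]
   either stays in the body of [x], or passes through [x] and then stays in
   [D] until it is back at [h]. *)
Lemma trapped_loop_edge B h (D : {set T}) x y :
  trapped B (h, D) -> x \in D -> loop_edge (accepts S) B x y ->
  exists z, loop_edge (accepts S) B h z.
Proof.
move=> [/= cl nc] xD /and3P[xy yx /eliminableP el].
have [xh _ xcyc] := nc x xD; have hx : h != x by rewrite eq_sym.
(* A return from [y] to [x] that avoids [h] would close a cycle at [x], against [xcyc]. *)
have [yh h_x] : connect (avoid B x) y h /\ connect B h x.
  have [yeq|yh] := eqVneq y h; first by rewrite -yeq connect0.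
  have [yx'|//] := connect_via hx yx; case/on_cycleP: xcyc; exists y => //.
  by apply/and3P.
have [z hz zx] : exists2 z, B h z & connect B z x.
  case/connectP: h_x => [[|z p]] /= pth lst; first by rewrite lst eqxx in xh.
  by case/andP: pth => hz pth; exists z => //; apply/connectP; exists p.
exists z; apply/and3P; split=> //.
  apply: (connect_trans zx); apply: (connect_trans (connect1 xy)).
  exact: connect_subrel (@sub_avoid _ _ _) _ _ yh.
apply/eliminableP => v zv vh.
have [/nc[]//|vD] := boolP (v \in D).
(* A path that avoids [h] and ends at [v] outside [D] cannot meet [x], so [el] applies to it. *)
have xv : x != v by apply: contraNneq vD => <-.
have nxv : ~ connect (avoid B h) x v.
  by move=> xv'; case/negP: vD; apply: connect_closed xv' xD => ? ?; apply: cl.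
have dodge u : connect (avoid B h) u v -> u != x /\ connect (avoid B x) u v.
  move=> uv; split; first by apply: contra_not_neq nxv => <-.
  have [uv'|[_ /nxv]//] := connect_via xv uv.
  exact: connect_subrel (avoid_subrel (@sub_avoid _ _ _)) _ _ uv'.
have [zx' zv'] := dodge z zv.
have [||av vcyc] := el v; last split=> //.
- apply: connect_trans yh (connect_trans (connect1 _) zv').
  by apply/and3P.
- by rewrite eq_sym.
apply: contra vcyc => /on_cycleP[w /and3P[vw _ _] /dodge[wx wv]].
by apply/on_cycleP; exists w => //; apply/and3P; split=> //; rewrite eq_sym.
Qed.

(* Histories list the eliminated loops, most recent first. *)
Definition conflict_free x c := (x != c.1) ==> (x \notin c.2).

Definition nested hist := pairwise (fun c d => conflict_free c.1 d) hist.

(* Whenever the current header lies in the body of an earlier loop, the header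
   of that loop is available too; since it was free of conflicts when it was
   chosen, it can only conflict with more recent loops. *)
Lemma conflict_free_loop_edge B hist :
  (forall c, c \in hist -> trapped B c) -> nested hist ->
  (exists x y, loop_edge (accepts S) B x y) ->
  exists x y, loop_edge (accepts S) B x y /\ all (conflict_free x) hist.
Proof.
move=> trap nest [x0 [y0 xy0]].
(* [l1] holds the recent loops still to be checked; passing to a header [h] shortens it to the loops
   more recent than [(h, D)]. *)
suff H n l1 l2 x y : size l1 <= n -> hist = l1 ++ l2 ->
    loop_edge (accepts S) B x y -> all (conflict_free x) l2 ->
    exists x y, loop_edge (accepts S) B x y /\ all (conflict_free x) hist.
  by apply: (H (size hist) hist [::] x0 y0) => //; rewrite cats0.
elim: n l1 l2 x y => [|n IH] l1 l2 x y sz hl xy cf2.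
  by exists x, y; split=> //; rewrite hl; case: l1 sz {hl}.
have [cf1|/allPn[[h D] hD]] := boolP (all (conflict_free x) l1).
  by exists x, y; split=> //; rewrite hl all_cat cf1.
rewrite negb_imply negbK => /andP[_ xD].
have trapD : trapped B (h, D) by apply: trap; rewrite hl mem_cat hD.
have [z hz] := trapped_loop_edge trapD xD xy.
have [p1 [p2 l1E]] : exists p1 p2, l1 = p1 ++ (h, D) :: p2.
  by have [p1 p2] := splitPr hD; exists p1, p2.
rewrite l1E -catA /= in hl sz.
apply: (IH p1 ((h, D) :: p2 ++ l2) h z) => //.
  by move: sz; rewrite size_cat /= addnS ltnS; apply: leq_trans; apply: leq_addr.
rewrite /= {1}/conflict_free eqxx /=.
by move: nest; rewrite /nested hl pairwise_cat pairwise_cons => /and3P[_ _ /andP[]].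
Qed.

(** The deleted edges are the future entry edges; [x |: D] allows for self-loops. *)
Definition elimination B hist : Prop :=
  [/\ subrel B (step S), forall c, c \in hist -> trapped B c, nested hist &
      forall x y, step S x y -> ~~ B x y -> connect (step S) y x /\
        exists2 D, (x, D) \in hist & y \in x |: D].

Lemma complete_elimination : loop_eliminating (accepts S) (step S) ->
  exists B hist, elimination B hist /\ forall z, ~~ on_cycle B z.
Proof.
move=> le.
suff H n B hist : #|[pred p | B p.1 p.2]| <= n -> elimination B hist ->
    exists B hist, elimination B hist /\ forall z, ~~ on_cycle B z.
  by apply: (H _ (step S) [::] (leqnn _)); split=> // x y ->.
elim: n B hist => [|n IH] B hist sz [sub trap nest elim].
  exists B, hist; split=> // z; apply/negP => /on_cycleP[w zw _].
  rewrite leqn0 in sz.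
  by have := card0_eq (elimT eqP sz) (z, w); rewrite inE /= zw.
have [/existsP cyc|/existsPn acyc] := boolP [exists z, on_cycle B z]; last first.
  by exists B, hist.
have [x [y [/and3P[xy yx /eliminableP el] cf]]] :=
  conflict_free_loop_edge trap nest (le B sub cyc).
pose B' : rel T := fun u v => B u v && ((u, v) != (x, y)).
have subB : subrel B' B by move=> u v /andP[].
(* The body of the loop at the moment of deletion; eliminability of the edge from [x] to [y] makes
   it trapped. *)
pose D := [set z | (z != x) && connect (avoid B x) y z].
apply: (IH B' ((x, D) :: hist)).
  rewrite -ltnS; apply: leq_trans sz; apply: proper_card; apply/properP; split.
    by apply/subsetP => p; rewrite !inE => /andP[].
  by exists (x, y); rewrite !inE //= /B' eqxx andbF.
split.
- by move=> u v /subB/sub.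
- move=> c; rewrite inE => /predU1P[->|/trap tc]; apply: (trapped_subrel subB) => //.
  split=> /= [u v|u]; rewrite !inE => /andP[ux yu].
    by move=> uv; case/and3P: (uv) => _ _ ->; apply: connect_trans (connect1 uv).
  by have [] := el u yu ux.
- by rewrite /nested /= cf.
move=> u v uv; rewrite negb_and negbK => /orP[/(elim _ _ uv)[vu [E uE vE]]|].
  by split=> //; exists E; rewrite // inE uE orbT.
case/eqP=> -> ->; split; first exact: connect_subrel yx.
by exists D; rewrite !inE ?eqxx // connect0 andbT orbN.
Qed.

(** This rank makes the loop relation acyclic. [index] finds the most recent loop at a header, and
    no loop more recent than [(x, D)] has header [z], as [z] lies in [D]. If [z] heads no loop, its
    index is the length of the list. *)
Lemma nested_index hist x D z : nested hist -> (x, D) \in hist -> z \in D ->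
  z != x -> index x (unzip1 hist) < index z (unzip1 hist).
Proof.
move=> nest xD zD zx; elim: hist nest xD => [//|c hist IH] /=.
case/andP=> cf nest; rewrite inE; have [cx|cx] := eqVneq c.1 x.
  by rewrite cx [x == z]eq_sym (negbTE zx).
case/predU1P=> [cE|xD]; first by rewrite -cE eqxx in cx.
have [cz|_] := eqVneq c.1 z; last by rewrite ltnS; apply: IH.
by have /implyP/(_ cx) := allP cf _ xD; rewrite /= cz zD.
Qed.

Lemma loop_eliminating_witness : loop_eliminating (accepts S) (step S) ->
  exists e b, layering_witness S e b.
Proof.
case/complete_elimination=> B [hist [[sub trap nest elim] acyc]].
pose e : rel T := fun u v => step S u v && ~~ B u v.
exists e, B.
(* The set recorded for the deleted edge from [x] to [v] is closed under [B]-steps avoiding [x], so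
   it contains the whole path. *)
have body x z : loops_to e B x z ->
    exists D, [/\ (x, D) \in hist, z \in D & z != x].
  case=> v [s [/andP[xv nxv] pth <- xs]].
  have zx : last v s != x by apply: contraNneq xs => <-; apply: mem_last.
  have [_ [D xD]] := elim x v xv nxv.
  case/setU1P=> [vx|vD]; first by rewrite vx mem_head in xs.
  exists D; split=> //; have [cl _] := trap _ xD.
  apply: connect_closed (_ : connect (avoid B x) v _) vD => [u w|].
    exact: cl.
  by apply/connectP; exists s => //; apply: path_avoid.
have toconn (r : rel T) u v : connect r u v -> u <> v -> clos_trans T r u v.
  case/connectP=> p; elim: p u => [|w p IH] u /=; first by move=> _ ->.
  case/andP=> uw pth lst _; have [wv|wv] := eqVneq w v.
    by rewrite -wv; apply: t_step.
  by apply: t_trans (t_step _ _ _ _ uw) (IH _ pth lst _); apply/eqP.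
split; [|split].
- move=> x y; split; last by case=> [/andP[]|/sub].
  by rewrite /e => ->; case: (B x y); [right | left].
- by move=> x; exists (enum T) => y _; rewrite mem_enum.
- by move=> x y /andP[_ /negP].
- split; last first.
    by move=> x y /andP[xy nxy] yx; apply: toconn => //; have [] := elim _ _ xy nxy.
  move=> x /clos_trans_t1n_iff xx; have /negP := acyc x; apply.
  have conn u v : clos_trans_1n T B u v -> exists2 w, B u w & connect B w v.
    elim=> {u v} [u v uv|u w v uw _ [w' ww' w'v]]; first by exists v; rewrite ?connect0.
    by exists w => //; apply: connect_trans (connect1 ww') w'v.
  exact/on_cycleP/conn.
- move=> x xx.
  have lt u v : clos_trans T (loops_to e B) u v ->
      index u (unzip1 hist) < index v (unzip1 hist).
    elim=> {u v} [u v /body[D [uD vD vu]]|u w v _ uw _ wv].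
      exact: nested_index uD vD vu.
    exact: ltn_trans wv.
  by have := lt _ _ xx; rewrite ltnn.
by move=> x z /body[D [/trap[_ nc] /nc[_ /negP]]].
Qed.

End ToWitness.

(** * Application to the quotient prechart *)

Theorem theorem4p1 (A : finType) (X : finType) (P : prechart A X)
    (R : equiv_rel X) (hP : well_layered P) (hR : bisimulation P R) :
  well_layered (quotient_prechart P R).
Proof.
case: hP => e [b /witness_loop_eliminating wit].
(* The quotient is finite because [repr] embeds it into [X]. *)
pose Q : finType := HB.pack {eq_quot R} (CanIsFinite (@reprK _ {eq_quot R})).
apply: (@loop_eliminating_witness Q (underlying (quotient_prechart P R))).
apply: (@loop_eliminating_image X Q (fun x => \pi_({eq_quot R}) x)) wit.
- by move=> q; exists (repr q); rewrite reprK.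
- move=> x q /existsP[a]; rewrite -[q]reprK => /(deriv_quotient hR)[y Ry xy].
  by exists y; [apply/existsP; exists a | apply/eqmodP].
by move=> x /existsP[a /(output_quotient hR) xa]; apply/existsP; exists a.
Qed.
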